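(* Let $\alpha\in(0,1)$ and assume that $\rho_r$ is real for every $r\in\{0,\ldots,q-1\}^d$. Then for any array of numbers $(g_x)_{x\in\mathcal V}$, where $\mathcal V=\{0,\ldots,q-1\}^d$, $$\frac14\sum_{x,y\in\mathcal V}\mathbb{P}(y\mid x)(g_x-g_y)^2+\frac12\,\frac{1-\alpha}{\alpha}\sum_{x\in\mathcal V}g_x^2=\frac{1}{2\alpha}\sum_{x,y\in\mathcal V}G^{(-1)}(x,y;\alpha)\,g_xg_y.$$ The identity is invariant under any scale change $\widetilde g_x=c\,g_x$ for a constant $c$.
   Context: Let $q\ge2$, $d\ge1$ be integers, $\theta_1=e^{2\pi i/q}$. Let $V$ be a random variable with values in $\mathcal V=\{0,\ldots,q-1\}^d$ and $\rho_r=\mathbb{E}[\theta_1^{V\cdot r}]$, $V\cdot r=\sum_{k=1}^dV[k]r[k]$. The random walk is $X_{t+1}=X_t+Z_t\bmod q$ (entrywise), $t=0,1,2,\ldots$, with $(Z_t)$ i.i.d. distributed as $V$ and independent of $X_0$; $\mathbb{P}(y\mid x)=\mathbb{P}(X_1=y\mid X_0=x)$ is its one-step transition probability. The Green function is $G(x,y;\alpha)=\sum_{t=0}^\infty\alpha^t\,\mathbb{P}(X_t=y\mid X_0=x)$, and $G^{(-1)}(x,y;\alpha)$ denotes the $(x,y)$ entry of the inverse of the matrix $(G(x,y;\alpha))_{x,y\in\mathcal V}$. *)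

(* Defs.v *)
From HB Require Import structures.
From mathcomp Require Import all_boot all_order all_algebra.
From mathcomp Require Export complex.
From mathcomp Require Import all_classical all_reals all_analysis.

Set Implicit Arguments.
Unset Strict Implicit.
Unset Printing Implicit Defensive.

Import Order.TTheory GRing.Theory Num.Theory.
Import numFieldNormedType.Exports.

Local Open Scope classical_set_scope.
Local Open Scope ring_scope.
Local Open Scope complex_scope.

Notation state q d := {ffun 'I_d -> 'I_q}.

Section RandomElements.
Context {R : realType} {dT : measure_display} {T : measurableType dT}.
Context (P : probability T R).

(* Random element of a finite type S carrying the discrete sigma-algebra. *)
Definition random_element (S : finType) (X : T -> S) : Prop :=
  forall s : S, measurable (X @^-1` [set s]).

Definition mutually_independent (I : eqType) (S : Type) (X : I -> T -> S) :
    Prop :=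
  forall (F : seq I) (A : I -> set S), uniq F ->
    P (\big[setI/setT]_(i <- F) (X i @^-1` A i))
    = (\prod_(i <- F) P (X i @^-1` A i))%E.

(* Y is independent of the whole family X; the finite-dimensional cylinder
   events form a pi-system generating the sigma-algebra of the family. *)
Definition independent_of_family (I : eqType) (S S' : Type)
    (Y : T -> S') (X : I -> T -> S) : Prop :=
  forall (F : seq I) (A : I -> set S) (B : set S'), uniq F ->
    P ((Y @^-1` B) `&` \big[setI/setT]_(i <- F) (X i @^-1` A i))
    = (P (Y @^-1` B) * P (\big[setI/setT]_(i <- F) (X i @^-1` A i)))%E.

Definition cond_prob (A B : set T) : R := fine (P (A `&` B)) / fine (P B).

Definition cexpectation (f : T -> R[i]) : R[i] :=
  fine 'E_P[fun w => complex.Re (f w)] +i* fine 'E_P[fun w => complex.Im (f w)].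

End RandomElements.

Definition theta1 (R : realType) (q : nat) : R[i] :=
  cos (2 * pi / q%:R) +i* sin (2 * pi / q%:R).

(* The dot product is taken in nat, without reduction mod q. *)
Definition dot (q d : nat) (v r : state q d) : nat :=
  (\sum_(k < d) (v k : nat) * (r k : nat))%N.

Definition rho (R : realType) (q d : nat) (dT : measure_display)
    (T : measurableType dT) (P : probability T R) (V : T -> state q d)
    (r : state q d) : R[i] :=
  cexpectation P (fun w => theta1 R q ^+ dot (V w) r).

Definition is_random_walk (q d : nat) (T : Type)
    (X Z : nat -> T -> state q d) : Prop :=
  forall t w k, (X t.+1 w k : nat) = ((X t w k + Z t w k) %% q)%N.

Section Green.
Context {R : realType} {q d : nat}.
Context {dT : measure_display} {T : measurableType dT} (P : probability T R).
Context (X : nat -> T -> state q d).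

(* P(X_t = y | X_0 = x), meaningful when X_0 charges x. *)
Definition trans_prob (t : nat) (x y : state q d) : R :=
  cond_prob P (X t @^-1` [set y]) (X 0%N @^-1` [set x]).

Definition green_series (alpha : R) (x y : state q d) : nat -> R :=
  series (fun t => alpha ^+ t * trans_prob t x y).

Definition green (alpha : R) (x y : state q d) : R :=
  limn (green_series alpha x y).

(* Matrices indexed by states, through the enumeration of the finite type. *)
Definition green_mx (alpha : R) : 'M[R]_#|{: state q d}| :=
  \matrix_(i, j) green alpha (enum_val i) (enum_val j).

Definition green_inv (alpha : R) (x y : state q d) : R :=
  invmx (green_mx alpha) (enum_rank x) (enum_rank y).

Definition energy (alpha : R) (g : state q d -> R[i]) : R[i] :=
  4%:R^-1 * (\sum_(x : state q d) \sum_(y : state q d)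
               (trans_prob 1 x y)%:C * (g x - g y) ^+ 2)
  + 2%:R^-1 * ((1 - alpha) / alpha)%:C * \sum_(x : state q d) g x ^+ 2.

Definition green_form (alpha : R) (g : state q d -> R[i]) : R[i] :=
  (2%:R * alpha%:C)^-1 *
  \sum_(x : state q d) \sum_(y : state q d)
     (green_inv alpha x y)%:C * g x * g y.

End Green.

(* Main.v *)
Require Import Defs.
From HB Require Import structures.
From mathcomp Require Import all_boot all_order all_algebra.
From mathcomp Require Import complex.
From mathcomp Require Import all_classical all_reals all_analysis.
From mathcomp Require Import ring.

(** Write A for the one-step transition matrix and a for alpha.  By the Markov
property ([trans_probE]) the t-step transition probabilities are the entries
of A^t, so the Green matrix is the Neumann series of a * A and its inverse is
1 - a * A ([neumann_mul]).  Hence the right-hand side of the identity is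
  (1 / 2a) * (sum_x g_x^2 - a * sum_(x,y) A(x,y) g_x g_y).
On the left-hand side, expanding (g_x - g_y)^2 produces the same cross terms,
together with sums of g_x^2 weighted by row sums and of g_y^2 weighted by
column sums of A.  The rows of A sum to 1 because A is stochastic; the columns
do too, because for each fixed increment v the translation x -> x + v permutes
the group of states.  With both sums equal to 1 the two sides agree
([energy_doubly_stochastic]).

The Markov property is obtained from the independence of the increments
through a statement stable under induction on t ([walk_joint_law]): the joint
law of X_0, X_t and any finite family of increments of index at least t. *)

Set Implicit Arguments.
Unset Strict Implicit.
Unset Printing Implicit Defensive.

Import Order.TTheory GRing.Theory Num.Theory.
Import numFieldNormedType.Exports.

Local Open Scope classical_set_scope.
Local Open Scope ring_scope.
Local Open Scope complex_scope.

(** * Energy of a doubly stochastic kernel *)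

(** The diagonal part of the Dirichlet form is half the sum of the row-weighted
and column-weighted sums of squares, hence the plain sum of g^2 once all row
and column sums are 1; the remaining cross terms are those of the right-hand
side. *)
Lemma energy_doubly_stochastic (F : numFieldType) (S : finType) (K : S -> S -> F)
    (a : F) (g : S -> F) :
    (forall x, \sum_y K x y = 1) -> (forall y, \sum_x K x y = 1) -> a != 0 ->
  4^-1 * (\sum_x \sum_y K x y * (g x - g y) ^+ 2)
    + 2^-1 * ((1 - a) / a) * \sum_x g x ^+ 2
  = (2 * a)^-1 * \sum_x \sum_y ((x == y)%:R - a * K x y) * g x * g y.
Proof.
move=> K1 K1' a0.
have -> : \sum_x \sum_y K x y * (g x - g y) ^+ 2
    = 2 * (\sum_x g x ^+ 2) - 2 * \sum_x \sum_y K x y * g x * g y.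
  transitivity (\sum_x \sum_y (K x y * g x ^+ 2 + K x y * g y ^+ 2
                               - 2 * (K x y * g x * g y))).
    by apply: eq_bigr => x _; apply: eq_bigr => y _; ring.
  under eq_bigr => x _ do
    rewrite sumrB big_split /= -mulr_suml K1 mul1r -mulr_sumr.
  rewrite sumrB big_split /= -mulr_sumr; congr (_ - _).
  rewrite exchange_big /= mulr_natl mulr2n; congr (_ + _).
  by apply: eq_bigr => y _; rewrite -mulr_suml K1' mul1r.
have -> : \sum_x \sum_y ((x == y)%:R - a * K x y) * g x * g y
    = \sum_x g x ^+ 2 - a * \sum_x \sum_y K x y * g x * g y.
  rewrite mulr_sumr -sumrB; apply: eq_bigr => x _.
  under eq_bigr do rewrite !mulrBl -!mulrA.
  rewrite sumrB -mulr_sumr (bigD1 x)//= eqxx mul1r big1 ?addr0 -?expr2.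
    by congr (_ - a * _); apply: eq_bigr => y _; rewrite mulrA.
  by move=> y /negPf; rewrite eq_sym => ->; rewrite mul0r.
by field.
Qed.

(** * Neumann series of a power-bounded matrix *)

Lemma expmxSr (R : pzRingType) n (A : 'M[R]_n) t : A ^+ t.+1 = A ^+ t *m A.
Proof. exact: exprSr. Qed.

Section Neumann.
Context (R : realType) (n : nat) (A : 'M[R]_n) (a : R).
Hypothesis a01 : 0 < a < 1.
Hypothesis A_le1 : forall t i j, `|(A ^+ t) i j| <= 1.

Lemma neumann_cvg i j : cvgn (series (fun t => a ^+ t * (A ^+ t) i j)).
Proof.
case/andP: a01 => a0 a1.
apply: normed_cvg; apply: (@series_le_cvg _ _ (geometric 1 a)).
- by move=> t /=.
- by move=> t; rewrite /geometric /= mul1r exprn_ge0// ltW.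
- move=> t; rewrite /geometric /= mul1r normrM ger0_norm ?exprn_ge0 ?(ltW a0)//.
  by rewrite ler_piMr// exprn_ge0// ltW.
- by apply: is_cvg_geometric_series; rewrite ger0_norm// ltW.
Qed.

(** The partial sums satisfy S_(N+1) = 1 + a * S_N * A; passing to the limit
entrywise gives G = 1 + a * G * A. *)
Lemma neumann_mul :
  (\matrix_(i, j) limn (series (fun t => a ^+ t * (A ^+ t) i j)))
    *m (1%:M - a *: A) = 1%:M.
Proof.
set u := fun i j => series (fun t => a ^+ t * (A ^+ t) i j).
rewrite mulmxBr mulmx1 -scalemxAr; apply/matrixP => i j.
rewrite !mxE; apply/eqP; rewrite subr_eq; apply/eqP.
have uS N : u i j N.+1 = (i == j)%:R + a * \sum_k u i k N * A k j.
  rewrite /u /series /= big_nat_recl//= expr0 mul1r expr0 mxE; congr (_ + _).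
  under [in RHS]eq_bigr do rewrite mulr_suml.
  rewrite exchange_big /= mulr_sumr; apply: eq_bigr => t _.
  rewrite expmxSr mxE exprS mulr_sumr mulr_sumr.
  by apply: eq_bigr => k _; ring.
have cvg_u k l : u k l N @[N --> \oo] --> limn (u k l).
  exact: neumann_cvg.
have uS_cvg : u i j N.+1 @[N --> \oo] -->
    (i == j)%:R + a * \sum_k limn (u i k) * A k j.
  under eq_fun do rewrite uS.
  apply: cvgD; first exact: cvg_cst.
  apply: cvgMl_tmp; apply: cvg_big => [|k _]; first exact: add_continuous.
  by apply: cvgMr_tmp; exact: cvg_u.
have {}uS_cvg : u i j N @[N --> \oo] --> (i == j)%:R
    + a * \sum_k limn (u i k) * A k j by rewrite -cvg_shiftS.
rewrite (cvg_unique _ (cvg_u i j) uS_cvg)//; congr (_ + _ * _).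
by apply: eq_bigr => k _; rewrite mxE.
Qed.
End Neumann.

(** * Finite-valued random elements *)

Lemma fine_prob_partition (R : realType) (dT : measure_display)
    (T : measurableType dT) (P : probability T R) (S : finType) (W : T -> S)
    (B : set T) : random_element W -> measurable B ->
  fine (P B) = \sum_s fine (P (B `&` W @^-1` [set s])).
Proof.
move=> mW mB.
have mBW s : measurable (B `&` W @^-1` [set s]) by exact: measurableI.
rewrite sum_fine => [|s _]; last exact: fin_num_measure.
rewrite [in RHS](@fsbig_seq _ _ _ S)/= ?index_enum_uniq//.
rewrite -measure_fin_bigcup//.
  by congr (fine (P _)); apply/seteqP; split=> [w Bw|w [s _ []]//];
    exists (W w) => //=; rewrite mem_index_enum.
by move=> s s' _ _ [w [[_ /= <-] [_ /= <-]]].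
Qed.

(** * The one-step transition matrix *)

Section Shift.
Context {q d : nat}.

(** The bound 0 < q required by [ltn_pmod] comes from the inhabitant [x k] of
['I_q], so that the group law makes sense for every q. *)
Definition shift (x v : state q d) : state q d :=
  [ffun k => Ordinal (ltn_pmod (x k + v k)
    (leq_ltn_trans (leq0n (x k)) (ltn_ord (x k))))].

Lemma shift_inj v : injective (shift^~ v).
Proof.
move=> x y /ffunP xy; apply/ffunP => k; apply/val_inj/eqP.
move: (xy k); rewrite !ffunE => /(congr1 val) /= /eqP.
by rewrite eqn_modDr !modn_small.
Qed.

Definition step_mx {R : realType} (p : state q d -> R) : 'M[R]_#|{: state q d}| :=
  \matrix_(i, j) \sum_(v | shift (enum_val i) v == enum_val j) p v.

Lemma step_mxE {R : realType} (p : state q d -> R) x y :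
  step_mx p (enum_rank x) (enum_rank y) = \sum_(v | shift x v == y) p v.
Proof. by rewrite mxE !enum_rankK. Qed.

Lemma step_row_sum {R : realType} (p : state q d -> R) x :
  \sum_v p v = 1 ->
  \sum_y step_mx p (enum_rank x) (enum_rank y) = 1.
Proof.
move=> p1; under eq_bigr do rewrite step_mxE big_mkcond /=.
rewrite exchange_big -[RHS]p1 /=; apply: eq_bigr => v _.
by rewrite -big_mkcond (big_pred1 (shift x v))// => y /=; rewrite eq_sym.
Qed.

(** Summing over the starting point, each increment v is counted exactly once
for the target y, since translation by v is a permutation. *)
Lemma step_col_sum {R : realType} (p : state q d -> R) y :
  \sum_v p v = 1 ->
  \sum_x step_mx p (enum_rank x) (enum_rank y) = 1.
Proof.
move=> p1; under eq_bigr do rewrite step_mxE big_mkcond /=.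
rewrite exchange_big -[RHS]p1 /=; apply: eq_bigr => v _.
transitivity (\sum_x if x == y then p v else 0).
  by rewrite [RHS](reindex_inj (@shift_inj v)).
by rewrite -big_mkcond big_pred1_eq.
Qed.

End Shift.

(** * The Markov property of the walk *)

Section Walk.
Context {R : realType} {q d : nat} {dT : measure_display}.
Context {T : measurableType dT} (P : probability T R).
Context (X Z : nat -> T -> state q d) (p : state q d -> R).
Hypothesis X0_meas : random_element (X 0%N).
Hypothesis Z_meas : forall t, random_element (Z t).
Hypothesis walkX : is_random_walk X Z.
Hypothesis Z_law : forall t v, fine (P (Z t @^-1` [set v])) = p v.
Hypothesis Z_indep : mutually_independent P Z.
Hypothesis X0_indep : independent_of_family P (X 0%N) Z.

Let preimage_meas (W : T -> state q d) (A : set (state q d)) :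
  random_element W -> measurable (W @^-1` A).
Proof.
move=> mW; rewrite (_ : _ @^-1` A = \bigcup_(s in A) W @^-1` [set s]).
  by apply: fin_bigcup_measurable.
by apply/seteqP; split=> [w Aw|w [s As /= ->]//]; exists (W w).
Qed.

Lemma walkS t w : X t.+1 w = shift (X t w) (Z t w).
Proof. by apply/ffunP => k; apply: val_inj; rewrite ffunE /= walkX. Qed.

Lemma walk_meas t : random_element (X t).
Proof.
elim: t => [//|t IHt] y.
rewrite (_ : _ @^-1` _ = \bigcup_(u in [set: state q d])
  (X t @^-1` [set u] `&` Z t @^-1` [set v | shift u v = y])).
  apply: fin_bigcup_measurable => // u _.
  by apply: measurableI; [exact: IHt | exact: preimage_meas].
apply/seteqP; split=> [w /= <-|w [u _ [/= <- <-]]]; rewrite ?walkS//.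
by exists (X t w) => //=; rewrite walkS.
Qed.

(** Carrying the future increments along is what makes the induction go
through: the event X_(t+1) = y splits according to X_t = u and Z_t = v, and
the constraint on Z_t joins the family F, to which the case of t applies. *)
Lemma walk_joint_law t x y (F : seq nat) (A : nat -> set (state q d)) :
    uniq F -> all (leq t) F ->
  fine (P (X 0%N @^-1` [set x] `&` X t @^-1` [set y]
           `&` \big[setI/setT]_(i <- F) (Z i @^-1` A i)))
  = fine (P (X 0%N @^-1` [set x]))
    * (step_mx p ^+ t) (enum_rank x) (enum_rank y)
    * \prod_(i <- F) fine (P (Z i @^-1` A i)).
Proof.
have mX i u : measurable (X i @^-1` [set u]) by exact: walk_meas.
have mZ i B : measurable (Z i @^-1` B) by exact: preimage_meas.
elim: t y F A => [|t IHt] y F A uF tF.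
  rewrite expr0 mxE (inj_eq enum_rank_inj).
  have [<-{y}|xy] := eqVneq x y; last first.
    rewrite (_ : _ `&` _ = set0) ?measure0 ?mulr0 ?mul0r//.
    by rewrite -subset0 => w [[/= -> /eqP]]; rewrite (negPf xy).
  rewrite setIid X0_indep// Z_indep// mulr1.
  rewrite fineM ?fin_num_measure//; last first.
    by apply: prode_fin_num => i _; exact: fin_num_measure.
  congr (_ * _).
  rewrite -[RHS]/(fine (_%:E)) -prodEFin; congr fine; apply: eq_bigr => i _.
  by rewrite fineK// fin_num_measure.
(* The family A is overridden at t by the constraint Z_t = v; this leaves it
   unchanged on F, whose indices all exceed t. *)
pose B u v := X 0%N @^-1` [set x] `&` X t @^-1` [set u]
  `&` \big[setI/setT]_(i <- t :: F) (Z i @^-1` (if i == t then [set v] else A i)).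
have BE u v : B u v = X 0%N @^-1` [set x] `&` X t @^-1` [set u]
   `&` Z t @^-1` [set v] `&` \big[setI/setT]_(i <- F) (Z i @^-1` A i).
  rewrite /B big_cons eqxx [LHS]setIA; congr (_ `&` _).
  apply: eq_big_seq => i /(allP tF).
  by case: eqVneq => // ->; rewrite ltnn.
have tF' : all (leq t) (t :: F).
  by rewrite /= leqnn; apply: sub_all tF => i /ltnW.
have uF' : uniq (t :: F).
  by rewrite /= uF andbT; apply/negP => /(allP tF); rewrite ltnn.
have mF : measurable (\big[setI/setT]_(i <- F) (Z i @^-1` A i)).
  by apply: bigsetI_measurable.
rewrite (fine_prob_partition P (walk_meas t)); last first.
  by do ?apply: measurableI.
rewrite expmxSr mxE mulr_sumr mulr_suml.
rewrite (reindex_onto enum_rank enum_val) /=; last by move=> i _; rewrite enum_valK.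
rewrite [RHS](eq_bigl xpredT); last by move=> i; rewrite enum_rankK eqxx.
apply: eq_bigr => u _.
rewrite (fine_prob_partition P (Z_meas t)); last first.
  by do ?apply: measurableI.
rewrite step_mxE !mulr_sumr mulr_suml [RHS]big_mkcond /=.
apply: eq_bigr => v _; case: eqVneq => [<-|uvy]; last first.
  rewrite (_ : _ `&` _ = set0) ?measure0//.
  rewrite -subset0 => w [[[[_ /= Xy] _] /= Xu] /= Zv].
  by move: uvy; rewrite -Xu -Zv -walkS Xy eqxx.
rewrite [X in P X](_ : _ = B u v).
  rewrite IHt// big_cons eqxx Z_law !mulrA; congr (_ * _).
  apply: eq_big_seq => i /(allP tF).
  by case: eqVneq => // ->; rewrite ltnn.
rewrite BE; apply/seteqP; split=> w /=; rewrite !walkS.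
  by move=> [[[[? ?] ?] ?] ?].
by move=> [[[? <-] <-] ?].
Qed.

Lemma trans_probE t x y : (0 < P (X 0%N @^-1` [set x]))%E ->
  trans_prob P X t x y = (step_mx p ^+ t) (enum_rank x) (enum_rank y).
Proof.
move=> x0.
have := walk_joint_law (t := t) x y (F := [::]) (fun=> setT) isT isT.
rewrite !big_nil setIT mulr1 /trans_prob /cond_prob setIC => ->.
rewrite mulrAC mulfV ?mul1r// gt_eqF// fine_gt0// x0 /=.
by rewrite ltey_eq fin_num_measure.
Qed.

Lemma trans_prob_le1 t x y : `|trans_prob P X t x y| <= 1.
Proof.
have mX i u : measurable (X i @^-1` [set u]) by exact: walk_meas.
rewrite /trans_prob /cond_prob.
have mI := measurableI _ _ (mX t y) (mX 0%N x).
rewrite ger0_norm ?divr_ge0 ?fine_ge0//.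
have [->|P0] := eqVneq (fine (P (X 0%N @^-1` [set x]))) 0.
  by rewrite invr0 mulr0.
rewrite ler_pdivrMr ?lt_def ?P0 ?fine_ge0// mul1r.
by rewrite fine_le ?fin_num_measure// le_measure ?inE.
Qed.

End Walk.

(** * The energy identity *)

Theorem lemma5 (R : realType) (q d : nat) (hq : (2 <= q)%N) (hd : (1 <= d)%N)
  (d1 : measure_display) (T1 : measurableType d1) (Q : probability T1 R)
  (V : T1 -> state q d) (hV : random_element V)
  (d2 : measure_display) (T : measurableType d2) (P : probability T R)
  (X Z : nat -> T -> state q d)
  (hX0 : random_element (X 0%N)) (hZ : forall t, random_element (Z t))
  (hwalk : is_random_walk X Z)
  (hlaw : forall (t : nat) (A : set (state q d)),
      P (Z t @^-1` A) = Q (V @^-1` A))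
  (hindep : mutually_independent P Z)
  (hindep0 : independent_of_family P (X 0%N) Z)
  (hsupp : forall x : state q d, (0 < P (X 0%N @^-1` [set x]))%E)
  (alpha : R) (halpha : 0 < alpha < 1)
  (hrho : forall r : state q d, rho Q V r \is Num.real) :
  (* the Green function and the inverse of its matrix are well defined *)
  (forall x y : state q d, cvgn (green_series P X alpha x y)) /\
  green_mx P X alpha \in unitmx /\
  (forall g : state q d -> R[i],
      energy P X alpha g = green_form P X alpha g) /\
  (* a change of scale multiplies both sides by the same factor c^2 *)
  (forall (c : R[i]) (g : state q d -> R[i]),
      energy P X alpha (fun x => c * g x) = c ^+ 2 * energy P X alpha g /\
      green_form P X alpha (fun x => c * g x)
        = c ^+ 2 * green_form P X alpha g).
Proof.
pose p v := fine (Q (V @^-1` [set v])).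
have p1 : \sum_v p v = 1.
  rewrite -[RHS](_ : fine (Q setT) = 1); last by rewrite probability_setT.
  rewrite (fine_prob_partition Q hV)//.
  by apply: eq_bigr => v _; rewrite setTI.
have Zlaw t v : fine (P (Z t @^-1` [set v])) = p v by rewrite hlaw.
set A : 'M[R]_#|{: state q d}| := step_mx p.
have transE t x y :
    trans_prob P X t x y = (A ^+ t) (enum_rank x) (enum_rank y).
  exact: trans_probE (hsupp x).
have A_le1 t i j : `|(A ^+ t) i j| <= 1.
  rewrite -(enum_valK i) -(enum_valK j) -transE.
  exact: (trans_prob_le1 _ hX0 hZ hwalk).
have seriesE x y : green_series P X alpha x y =
    series (fun t => alpha ^+ t * (A ^+ t) (enum_rank x) (enum_rank y)).
  by rewrite /green_series; congr series; apply/funext => t; rewrite transE.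
have GA : green_mx P X alpha *m (1%:M - alpha *: A) = 1%:M.
  rewrite -[RHS](neumann_mul halpha A_le1); congr (_ *m _).
  by apply/matrixP => i j; rewrite !mxE /green seriesE !enum_valK.
have [G_unit _] := mulmx1_unit GA.
have a0 : alpha != 0 by case/andP: halpha => /gt_eqF->.
have GinvE x y : green_inv P X alpha x y
    = (x == y)%:R - alpha * A (enum_rank x) (enum_rank y).
  rewrite /green_inv -[invmx _]mulmx1 -GA mulKmx//.
  by rewrite mxE [1%:M _ _]mxE !mxE (inj_eq enum_rank_inj).
split; [|split; [|split]] => //.
- by move=> x y; rewrite seriesE; exact: neumann_cvg.
- move=> g; rewrite /energy /green_form.
  pose K x y := real_complex R (A (enum_rank x) (enum_rank y)).
  transitivity (4^-1 * (\sum_x \sum_y K x y * (g x - g y) ^+ 2)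
    + 2^-1 * ((1 - alpha%:C) / alpha%:C) * \sum_x g x ^+ 2).
    rewrite fmorph_div rmorphB rmorph1; congr (_ * _ + _).
    by apply: eq_bigr => x _; apply: eq_bigr => y _; rewrite transE expr1.
  rewrite energy_doubly_stochastic.
  + congr (_ * _); apply: eq_bigr => x _; apply: eq_bigr => y _.
    by rewrite GinvE rmorphB rmorphM rmorph_nat.
  + by move=> x; rewrite -rmorph_sum step_row_sum ?rmorph1.
  + by move=> y; rewrite -rmorph_sum step_col_sum ?rmorph1.
  + by rewrite fmorph_eq0.
move=> c g; rewrite /energy /green_form; split.
- rewrite mulrDr; congr (_ + _); rewrite mulrCA; congr (_ * _).
    rewrite mulr_sumr; apply: eq_bigr => x _; rewrite mulr_sumr.
    by apply: eq_bigr => y _; ring.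
  by rewrite mulr_sumr; apply: eq_bigr => x _; rewrite exprMn.
- rewrite mulrCA; congr (_ * _); rewrite mulr_sumr; apply: eq_bigr => x _.
  by rewrite mulr_sumr; apply: eq_bigr => y _; ring.
Qed.
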